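(* Binomial distributions satisfy the intersection property: let $n\ge1$ be an integer, $0<p<1$, and let $S_n$ be a random variable with binomial distribution $bin(n,p)$. Then for every integer $\ell$ with $0\le \ell\le n$, $$\Pr\left(S_{n}<\ell\right)<\Phi\left(G_{bin(n,p)}(\ell)\right)<\Pr\left(S_{n}\leq\ell\right),$$ where $G_{bin(n,p)}$ is the signed log-likelihood of $bin(n,p)$ and $\Phi$ is the distribution function of the standard Gaussian.
   Context: The signed log-likelihood of $bin(n,p)$ is $$G_{bin(n,p)}(\ell)=\begin{cases}-\left(2D\left(bin(n,\ell/n)\Vert bin(n,p)\right)\right)^{1/2}, & \ell<np,\\ +\left(2D\left(bin(n,\ell/n)\Vert bin(n,p)\right)\right)^{1/2}, & \ell\ge np,\end{cases}$$ where $$D\left(bin(n,q)\Vert bin(n,p)\right)=n\left(q\ln\frac{q}{p}+(1-q)\ln\frac{1-q}{1-p}\right),\qquad 0\ln 0=0.$$ *)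

(* Defs.v *)
From HB Require Import structures.
From mathcomp Require Export all_boot all_order all_algebra.
From mathcomp Require Export all_classical all_reals all_analysis.

Set Implicit Arguments.
Unset Strict Implicit.
Unset Printing Implicit Defensive.

Import Order.TTheory GRing.Theory Num.Theory.
Import numFieldNormedType.Exports.

Local Open Scope classical_set_scope.
Local Open Scope ring_scope.

(* The convention 0 ln 0 = 0 holds: at q = 0 (resp. q = 1) the first (resp.
   second) summand is 0 times a real number. *)
Definition binomial_divergence (R : realType) (n : nat) (q p : R) : R :=
  n%:R * (q * ln (q / p) + (1 - q) * ln ((1 - q) / (1 - p))).

Definition binomial_signed_loglik (R : realType) (n : nat) (p x : R) : R :=
  if x < n%:R * p then - Num.sqrt (2 * binomial_divergence n (x / n%:R) p)
  else Num.sqrt (2 * binomial_divergence n (x / n%:R) p).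

Definition std_normal_cdf (R : realType) (x : R) : \bar R :=
  normal_prob 0 1 `]-oo, x].

(* Main.v *)
Require Import Defs.
From HB Require Import structures.
From mathcomp Require Import zify ring lra measurable_realfun.
Set Implicit Arguments.
Unset Strict Implicit.
Unset Printing Implicit Defensive.

Import Order.TTheory GRing.Theory Num.Theory.
Import numFieldNormedType.Exports.

Local Open Scope classical_set_scope.
Local Open Scope ring_scope.

(** The symmetry [(p, l) -> (1 - p, n - l)] turns the lower bound into the upper
    bound [Phi (G l) < Pr (S <= l)], which is trivial for [l = n].  For [l < n]
    fix [n] and [l], put [q = l / n], and let [p] vary.  Both sides have
    explicit derivatives in [p]: that of the binomial tail is a multiple of
    [p ^ l * (1 - p) ^ (n - l - 1)], and, since [exp (- G ^ 2 / 2)] is a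
    multiple of [p ^ l * (1 - p) ^ (n - l)], so is that of [Phi (G l)] up to the
    factor [|q - p| / (p * |G|)].  This factor is strictly decreasing in [p], hence the
    gap [Pr (S <= l) - Phi (G l)] first increases and then decreases; being
    asymptotically nonnegative at both ends of [(0, 1)], it is positive. *)

(** * The standard normal distribution function *)

Section std_normal.
Context {R : realType}.
Implicit Types x y : R.
Local Notation mu := (@lebesgue_measure R).

Definition Phi x : R := fine (std_normal_cdf x).

Lemma std_normal_pdfE x :
  normal_pdf 0 1 x = normal_peak 1 * expR (- x ^+ 2 / 2).
Proof.
by rewrite normal_pdfE ?oner_neq0// /normal_fun subr0 expr1n.
Qed.

Lemma std_normal_cdfE x : std_normal_cdf x = (Phi x)%:E.
Proof.
rewrite /Phi fineK// /std_normal_cdf.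
exact: (@fin_num_measure _ _ _ (normal_prob 0 1)).
Qed.

Lemma std_normal_cdf_setC x :
  normal_prob 0 1 `]x, +oo[ = (1 - Phi x)%:E.
Proof.
rewrite EFinB -std_normal_cdfE /std_normal_cdf -setCitvl.
exact: (@probability_setC _ _ _ (normal_prob 0 1)).
Qed.

(** The density is even, so the substitution [y -> - y] exchanges the two half-lines; the endpoint
    is a null set. *)
Lemma PhiN x : Phi (- x) = 1 - Phi x.
Proof.
apply: EFin_inj; rewrite -std_normal_cdfE -std_normal_cdf_setC /std_normal_cdf.
rewrite /normal_prob ge0_integration_by_substitutionNy.
- rewrite integral_itv_obnd_cbnd.
    by apply: eq_integral => y _ /=; rewrite !std_normal_pdfE sqrrN.
  apply/measurable_EFinP; apply: measurable_funTS; exact: measurable_normal_pdf.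
- apply: continuous_subspaceT; exact: continuous_normal_pdf.
- by move=> y _; exact: normal_pdf_ge0.
Qed.

Lemma is_derive_Phi x : is_derive x 1 Phi (normal_pdf 0 1 x).
Proof.
(* The bound [x + 1] makes [x] interior to the half-line on which the fundamental theorem of
   calculus is applied. *)
have ix : x < x + 1 by rewrite ltrDl.
have iy : mu.-integrable `]-oo, x + 1] (EFin \o normal_pdf 0 1).
  by apply: integrableS (integrable_normal_pdf 0 1).
have /= := continuous_FTC1 ix iy.
move=> /(_ _ (@continuous_normal_pdf R 0 1 (oner_neq0 _) x))[|].
  by rewrite ltNyr.
by move=> dF <-; rewrite derive1E; exact: (derivableP dF).
Qed.

Lemma Phi_lt x y : x < y -> Phi x < Phi y.
Proof.
move=> xy; have [||c _] := @MVT R Phi (normal_pdf 0 1) x y xy.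
- by move=> z _; exact: is_derive_Phi.
- apply: continuous_subspaceT => z; apply: differentiable_continuous.
  by apply/derivable1_diffP; have := is_derive_Phi z; case.
move/eqP; rewrite subr_eq => /eqP ->; rewrite ltrDr mulr_gt0 ?subr_gt0//.
by rewrite std_normal_pdfE mulr_gt0 ?expR_gt0 ?normal_peak_gt0.
Qed.

Lemma Phi_ge0 x : 0 <= Phi x.
Proof. exact/fine_ge0/(measure_ge0 (normal_prob 0 1)). Qed.

Lemma Phi_lt1 x : Phi x < 1.
Proof.
rewrite (lt_le_trans (@Phi_lt x (x + 1) _)) ?ltrDl//.
by have := Phi_ge0 (- (x + 1)); rewrite PhiN subr_ge0.
Qed.

(** With the identity as a random variable under the Gaussian law, [Phi] becomes a [cdf] and
    inherits its limit at [-oo]. *)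
Let idTR : measurableTypeR R -> R := idfun.

#[local] HB.instance Definition _ :=
  @isMeasurableFun.Build _ _ _ _ idTR (@measurable_id _ _ setT).

Lemma cvg_PhiNy : Phi x @[x --> -oo] --> 0.
Proof.
pose N01 : probability _ R := normal_prob 0 1.
have := @cvg_cdfNy0 _ _ _ N01 (idTR : {RV N01 >-> R}).
rewrite (_ : cdf _ = EFin \o Phi); last first.
  by apply/funext => x; rewrite /= -std_normal_cdfE.
by move/fine_cvgP => [].
Qed.

End std_normal.

(** * Derivatives and monotonicity *)

Section calculus.
Context {R : realType}.
Implicit Types (f df : R -> R) (a b x : R).

Lemma is_derive_continuous f x (l : R) :
  is_derive x 1 f l -> {for x, continuous f}.
Proof.
by case=> dfx _; apply/differentiable_continuous/derivable1_diffP.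
Qed.

(** Differentiability is asked only inside the interval, so that an endpoint may be an exceptional
    point of [f]. *)
Lemma is_derive_gt0_lt f df a b : a < b ->
  (forall x, a <= x <= b -> {for x, continuous f}) ->
  (forall x, a < x < b -> is_derive x 1 f (df x)) ->
  (forall x, a < x < b -> 0 < df x) -> f a < f b.
Proof.
move=> ab cf dfP df0; rewrite -subr_gt0.
have dfP' x : x \in `]a, b[ -> is_derive x 1 f (df x).
  by rewrite in_itv/= => /dfP.
have cf' : {within `[a, b], continuous f}.
  by apply: continuous_in_subspaceT => x; rewrite inE/= in_itv/=; exact: cf.
have [c cab ->] := MVT ab dfP' cf'.
by rewrite mulr_gt0 ?subr_gt0// df0//; rewrite in_itv/= in cab.
Qed.

Lemma is_derive_lt0_lt f df a b : a < b ->
  (forall x, a <= x <= b -> {for x, continuous f}) ->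
  (forall x, a < x < b -> is_derive x 1 f (df x)) ->
  (forall x, a < x < b -> df x < 0) -> f b < f a.
Proof.
move=> ab cf dfP df0; rewrite -ltrN2.
apply: (@is_derive_gt0_lt (fun x => - f x) (fun x => - df x)) => //.
- by move=> x xab; apply: continuousN; exact: cf.
- by move=> x xab; apply: is_deriveN; exact: dfP.
- by move=> x xab; rewrite oppr_gt0 df0.
Qed.

Section pointwise.
Variables (f g : R -> R) (x a b : R).
Hypotheses (fa : is_derive x 1 f a) (gb : is_derive x 1 g b).

Lemma is_derive_ptD : is_derive x 1 (fun y => f y + g y) (a + b).
Proof. exact: (is_deriveD fa gb). Qed.

Lemma is_derive_ptB : is_derive x 1 (fun y => f y - g y) (a - b).
Proof. exact: (is_deriveB fa gb). Qed.

Lemma is_derive_ptM : is_derive x 1 (fun y => f y * g y) (f x * b + g x * a).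
Proof. exact: (is_deriveM fa gb). Qed.

Lemma is_derive_ptX n :
  is_derive x 1 (fun y => f y ^+ n) (n%:R * f x ^+ n.-1 * a).
Proof. by have := is_deriveX n fa; rewrite exprfctE. Qed.

Lemma is_derive_ptV : f x != 0 ->
  is_derive x 1 (fun y => (f y)^-1) (- a / f x ^+ 2).
Proof.
move=> fx0; have := @is_deriveV R f x a 1 fx0 fa.
by rewrite /GRing.scale/= mulNr mulrC -mulNr.
Qed.

Lemma is_derive_pt_comp (h : R -> R) (c : R) :
  is_derive (f x) 1 h c -> is_derive x 1 (fun y => h (f y)) (c * a).
Proof. by move=> hc; exact: (is_derive1_comp hc fa). Qed.

End pointwise.

Lemma is_derive_pt_cst (c x : R) : is_derive x 1 (fun=> c) 0.
Proof. exact: is_derive_cst. Qed.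

Lemma is_derive_pt_id (x : R) : is_derive x 1 (fun y => y) 1.
Proof. exact: is_derive_id. Qed.

Lemma is_derive_pt_eq f x a b : is_derive x 1 f a -> a = b -> is_derive x 1 f b.
Proof. by move=> ? <-. Qed.

End calculus.

(* Type class resolution of [is_derive] may diverge here, because it tries to
   unfold the function under the derivative. *)
Ltac derive_step :=
  lazymatch goal with
  | |- is_derive _ _ (fun=> ?c) _ => notypeclasses refine (is_derive_pt_cst _ _)
  | |- is_derive _ _ (fun y => y) _ => notypeclasses refine (is_derive_pt_id _)
  | |- is_derive _ _ (fun y => @?f y - @?g y) _ =>
    notypeclasses refine (is_derive_ptB _ _)
  | |- is_derive _ _ (fun y => @?f y + @?g y) _ =>
    notypeclasses refine (is_derive_ptD _ _)
  | |- is_derive _ _ (fun y => @?f y * @?g y) _ =>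
    notypeclasses refine (is_derive_ptM _ _)
  | |- is_derive _ _ (fun y => @?f y ^+ _) _ =>
    notypeclasses refine (is_derive_ptX _ _)
  | |- is_derive _ _ (fun y => (@?f y)^-1) _ =>
    notypeclasses refine (is_derive_ptV _ _); [|eassumption]
  | |- is_derive _ _ _ _ => eassumption
  end.

(** The rules compute the derivative into an existential variable; what remains is an algebraic
    identity. *)
Ltac derive_pt :=
  notypeclasses refine (is_derive_pt_eq _ _); [repeat derive_step|cbv beta].

(** * Positivity from the sign of a derivative, with one exceptional point *)

Section positivity.
Context {R : realType}.
Implicit Types (f df : R -> R) (a b x q : R).

Lemma is_derive_gt0_lt_but1 f df q a b : a < b ->
  (forall x, a <= x <= b -> {for x, continuous f}) ->
  (forall x, a < x < b -> x != q -> is_derive x 1 f (df x)) ->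
  (forall x, a < x < b -> x != q -> 0 < df x) -> f a < f b.
Proof.
move=> ab cf dfP df0.
have sub a' b' : a <= a' -> b' <= b -> a' < b' -> ~~ (a' < q < b') ->
    f a' < f b'.
  move=> aa' b'b a'b' qab.
  have neq x : a' < x < b' -> (a < x < b) /\ x != q.
    move=> /andP[ax xb]; rewrite (le_lt_trans aa' ax) (lt_le_trans xb b'b).
    split=> //.
    by apply: contraNneq qab => <-; rewrite ax.
  apply: (@is_derive_gt0_lt _ f df) => // x.
  - move=> /andP[ax xb]; apply: cf.
    by rewrite (le_trans aa' ax) (le_trans xb b'b).
  - by move=> /neq[]; exact: dfP.
  - by move=> /neq[]; exact: df0.
(* When [q] is inside, the two pieces are joined through [f q]. *)
have [/andP[aq qb]|] := boolP (a < q < b); last exact: sub.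
by rewrite (@lt_trans _ _ (f q))// sub ?(ltW aq) ?(ltW qb)// ltxx ?andbF.
Qed.

Lemma is_derive_lt0_lt_but1 f df q a b : a < b ->
  (forall x, a <= x <= b -> {for x, continuous f}) ->
  (forall x, a < x < b -> x != q -> is_derive x 1 f (df x)) ->
  (forall x, a < x < b -> x != q -> df x < 0) -> f b < f a.
Proof.
move=> ab cf dfP df0; rewrite -ltrN2.
apply: (@is_derive_gt0_lt_but1 (fun x => - f x) (fun x => - df x) q) => //.
- by move=> x xab; apply: continuousN; exact: cf.
- by move=> x xab xq; apply: is_deriveN; exact: dfP.
- by move=> x xab xq; rewrite oppr_gt0 df0.
Qed.

(** The last two hypotheses say that the limsup of [W] at each end is nonnegative. As [s] decreases,
    either it is positive before [x] and [W] increases up to [x], or it is nonpositive somewhere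
    before [x] and [W] decreases from [x] on; [W x] is then compared with the values near [a] or
    near [b]. *)
Lemma gt0_of_derive_sign (W w s : R -> R) q a b :
  (forall x, a < x < b -> {for x, continuous W}) ->
  (forall x, a < x < b -> x != q -> is_derive x 1 W (w x * s x)) ->
  (forall x, a < x < b -> 0 < w x) ->
  (forall x y, a < x -> x < y -> y < b -> x != q -> y != q -> s y < s x) ->
  (forall x e, a < x < b -> 0 < e -> exists2 y, a < y < x & - e < W y) ->
  (forall x e, a < x < b -> 0 < e -> exists2 y, x < y < b & - e < W y) ->
  forall x, a < x < b -> 0 < W x.
Proof.
move=> cW dW w0 sdecr Wa Wb x /andP[ax xb].
have [spos|] := pselect (forall y, a < y < x -> y != q -> 0 < s y).
  have Wincr y z : a < y -> y < z -> z <= x -> W y < W z.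
    move=> ay yz zx.
    apply: (@is_derive_gt0_lt_but1 _ (fun y => w y * s y) q) => // t.
    - by move=> /andP[yt tz]; apply: cW; lra.
    - by move=> /andP[yt tz]; apply: dW; lra.
    - move=> /andP[yt tz] tq; rewrite mulr_gt0//; first by apply: w0; lra.
      by apply: spos => //; lra.
  (* The midpoint provides strictness: its value is nonnegative, since a negative one would bound
     [W] away from 0 near [a]. *)
  apply: (@le_lt_trans _ _ (W ((a + x) / 2))); last by apply: Wincr; lra.
  rewrite leNgt; apply/negP => Wm.
  have [||y /andP[ay yx] Wy] := Wa ((a + x) / 2) (- W ((a + x) / 2)).
  - lra.
  - lra.
  have : W y < W ((a + x) / 2) by apply: Wincr; lra.
  by rewrite opprK in Wy; lra.
move=> /existsNP[c] /not_implyP[/andP[ac cx]] /not_implyP[cq /negP].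
rewrite -leNgt => sc.
have Wdecr y z : x <= y -> y < z -> z < b -> W z < W y.
  move=> xy yz zb.
  apply: (@is_derive_lt0_lt_but1 _ (fun y => w y * s y) q) => // t.
  - by move=> /andP[yt tz]; apply: cW; lra.
  - by move=> /andP[yt tz]; apply: dW; lra.
  - move=> /andP[yt tz] tq; rewrite pmulr_rlt0//; last by apply: w0; lra.
    by apply: lt_le_trans sc; apply: sdecr => //; lra.
apply: (@le_lt_trans _ _ (W ((x + b) / 2))); last by apply: Wdecr; lra.
rewrite leNgt; apply/negP => Wm.
have [||y /andP[ay yx] Wy] := Wb ((x + b) / 2) (- W ((x + b) / 2)); [lra|lra|].
have : W y < W ((x + b) / 2) by apply: Wdecr; lra.
by rewrite opprK in Wy; lra.
Qed.

End positivity.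

(** * The binomial distribution function *)

Section binomial_cdf.
Context {R : realType}.
Definition binomial_cdf n l (p : R) : R := \sum_(k < l.+1) binomial_pmf n p k.

Lemma binomial_pmfE n (p : R) k :
  binomial_pmf n p k = p ^+ k * (1 - p) ^+ (n - k) * 'C(n, k)%:R.
Proof. by rewrite mulr_natr. Qed.

Lemma is_derive_binomial_pmf n k (p : R) :
  is_derive p 1 (fun x => binomial_pmf n x k)
  ((k%:R * p ^+ k.-1 * (1 - p) ^+ (n - k)
   - (n - k)%:R * p ^+ k * (1 - p) ^+ (n - k).-1) * 'C(n, k)%:R).
Proof.
under eq_fun do rewrite binomial_pmfE.
derive_pt.
by rewrite /=; ring.
Qed.

(** The derivatives of the terms telescope, because [l.+1 * 'C(n, l.+1) = (n - l) * 'C(n, l)]. *)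
Lemma is_derive_binomial_cdf n l (p : R) : (l < n)%N ->
  is_derive p 1 (binomial_cdf n l)
    (- ((n - l)%:R * 'C(n, l)%:R * (p ^+ l * (1 - p) ^+ (n - l).-1))).
Proof.
elim: l => [|l IH] ln.
  rewrite (_ : binomial_cdf n 0 = (fun x => binomial_pmf n x 0)); last first.
    by apply/funext => x; rewrite /binomial_cdf big_ord1.
  apply: (is_derive_pt_eq (is_derive_binomial_pmf n 0 p)).
  by rewrite bin0 subn0; ring.
rewrite (_ : binomial_cdf n l.+1 =
    (fun x => binomial_cdf n l x + binomial_pmf n x l.+1)); last first.
  by apply/funext => x; rewrite /binomial_cdf big_ord_recr.
apply: (is_derive_pt_eq
  (is_derive_ptD (IH (ltnW ln)) (is_derive_binomial_pmf n l.+1 p))).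
have := mul_bin_left n l => /(congr1 (GRing.natmul (1 : R))).
rewrite !natrM -subn1 -subnDA addn1 => Cl.
by rewrite subnS -subn1 mulrBl -Cl !subn1/=; ring.
Qed.

Lemma binomial_cdf_at0 n l : binomial_cdf n l (0 : R) = 1.
Proof.
rewrite /binomial_cdf big_ord_recl big1 => [|i _].
  by rewrite binomial_pmfE bin0 expr0 subr0 expr1n !mulr1 addr0.
by rewrite binomial_pmfE lift0 expr0n !mul0r.
Qed.

Lemma sum_binomial_pmf n (p : R) : \sum_(k < n.+1) binomial_pmf n p k = 1.
Proof.
under eq_bigr do rewrite binomial_pmfE mulr_natr mulrC.
by rewrite -exprDn subrK expr1n.
Qed.

Lemma binomial_pmfC n k (p : R) : (k <= n)%N ->
  binomial_pmf n (1 - p) k = binomial_pmf n p (n - k).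
Proof.
move=> kn; rewrite !binomial_pmfE bin_sub// subKn// subKr.
by rewrite [in RHS](mulrC (p ^+ _)).
Qed.

(** If [S] has law [bin(n, p)], then [n - S] has law [bin(n, 1 - p)], and [S >= l] means
    [n - S <= n - l]. *)
Lemma binomial_cdfC n l (p : R) : (l <= n)%N ->
  \sum_(k < l) binomial_pmf n p k = 1 - binomial_cdf n (n - l) (1 - p).
Proof.
move=> ln; have := sum_binomial_pmf n p.
rewrite -!(big_mkord xpredT (binomial_pmf n p)).
rewrite (big_cat_nat (n := l))//=; last by rewrite leqW.
move/eqP; rewrite eq_sym -subr_eq eq_sym => /eqP ->; congr (_ - _).
rewrite -{1}(add0n l) big_addn subSn// big_mkord.
rewrite /binomial_cdf [RHS](reindex_inj rev_ord_inj)/=.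
apply: eq_bigr => i _.
have il : (i <= n - l)%N by rewrite -ltnS.
rewrite subSS binomial_pmfC; last by lia.
by congr binomial_pmf; lia.
Qed.

End binomial_cdf.

(** * The divergence as a function of its second argument *)

Section bernoulli_kl.
Context {R : realType}.
Variable q : R.
Hypotheses (q0 : 0 <= q) (q1 : q < 1).
Implicit Types p : R.

(** The Kullback-Leibler divergence between Bernoulli laws, with the logarithms split so that the
    formula can be differentiated in [p] uniformly, including for [q = 0]. *)
Definition bernoulli_kl p :=
  q * ln q + (1 - q) * ln (1 - q) - q * ln p - (1 - q) * ln (1 - p).
Local Notation d := bernoulli_kl.

Lemma bernoulli_klE p : 0 < p < 1 ->
  q * ln (q / p) + (1 - q) * ln ((1 - q) / (1 - p)) = d p.
Proof.
move=> /andP[p0 p1]; rewrite /d (@ln_div _ (1 - q)) ?posrE ?subr_gt0//.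
have [->|qn0] := eqVneq q 0; first by ring.
have q_gt0 : 0 < q by rewrite lt0r qn0.
by rewrite ln_div ?posrE//; ring.
Qed.

Lemma bernoulli_kl_diag : d q = 0.
Proof. by rewrite /d; ring. Qed.

Lemma is_derive_bernoulli_kl p : 0 < p < 1 ->
  is_derive p 1 d ((p - q) / (p * (1 - p))).
Proof.
move=> /andP[p0 p1]; have p1' : 0 < 1 - p by rewrite subr_gt0.
have lnp := is_derive1_ln p0.
have lnp1 : is_derive p 1 (fun x => ln (1 - x)) ((1 - p)^-1 * (0 - 1)).
  notypeclasses refine
    (is_derive_pt_comp (f := fun x => 1 - x) _ (is_derive1_ln p1')).
  by repeat derive_step.
rewrite /bernoulli_kl; derive_pt.
by field; rewrite ?gt_eqF.
Qed.

(* [E] has the sign of [(p - q) * rho'] for the function [rho] below, which is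
   the squared [slope] up to a constant; [A] has the sign of [rho p - 2 * (1 - q) / q], where
   the constant is the limit of [rho] at the singular point [q]. *)
Let E p := 2 * q * d p - (q - p) ^+ 2 * (1 - p)^-1.
Let A p := q * (q - p) ^+ 2 * (p ^+ 2)^-1 - 2 * (1 - q) * d p.

Let is_deriveE p : 0 < p < 1 ->
  is_derive p 1 E (- ((p - q) ^+ 2 * (2 - p) / (p * (1 - p) ^+ 2))).
Proof.
move=> p01; have dd := is_derive_bernoulli_kl p01; case/andP: p01 => p0 p1.
have np : p != 0 by rewrite gt_eqF.
have np1 : 1 - p != 0 by rewrite gt_eqF ?subr_gt0.
rewrite /E; derive_pt.
by field; rewrite np np1.
Qed.

Let is_deriveA p : 0 < p < 1 ->
  is_derive p 1 A
    (- (2 * (p - q) ^+ 2 * (p + q * (1 - p)) / (p ^+ 3 * (1 - p)))).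
Proof.
move=> p01; have dd := is_derive_bernoulli_kl p01; case/andP: p01 => p0 p1.
have np : p != 0 by rewrite gt_eqF.
have np1 : 1 - p != 0 by rewrite gt_eqF ?subr_gt0.
have np2 : p ^+ 2 != 0 by rewrite expf_neq0.
rewrite /A; derive_pt.
by field; rewrite np np1.
Qed.

(** The derivative carries the factor [(p - q) ^+ 2], positive off [q]. Taking [q] as an endpoint
    gives the sign of [E] on each side. *)
Let decrE x y : 0 < x -> x < y -> y < 1 -> ~~ (x < q < y) -> E y < E x.
Proof.
move=> x0 xy y1 qxy.
apply: (@is_derive_lt0_lt _ E (fun p =>
  - ((p - q) ^+ 2 * (2 - p) / (p * (1 - p) ^+ 2))) _ _ xy) => p.
- move=> /andP[xp py]; have p01 : 0 < p < 1 by lra.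
  exact: is_derive_continuous (is_deriveE p01).
- by move=> /andP[xp py]; apply: is_deriveE; lra.
- move=> /andP[xp py]; rewrite oppr_lt0 divr_gt0//; last first.
    by rewrite mulr_gt0 ?exprn_gt0//; lra.
  have pq2 : 0 < (p - q) ^+ 2.
    rewrite exprn_even_gt0//= subr_eq0.
    by apply: contraNneq qxy => <-; rewrite xp.
  by rewrite mulr_gt0//; lra.
Qed.

Let decrA x y : 0 < x -> x < y -> y < 1 -> ~~ (x < q < y) -> A y < A x.
Proof.
move=> x0 xy y1 qxy.
apply: (@is_derive_lt0_lt _ A (fun p =>
  - (2 * (p - q) ^+ 2 * (p + q * (1 - p)) / (p ^+ 3 * (1 - p)))) _ _ xy) => p.
- move=> /andP[xp py]; have p01 : 0 < p < 1 by lra.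
  exact: is_derive_continuous (is_deriveA p01).
- by move=> /andP[xp py]; apply: is_deriveA; lra.
- move=> /andP[xp py]; rewrite oppr_lt0 divr_gt0//; last first.
    by rewrite mulr_gt0 ?exprn_gt0//; lra.
  have qp : 0 <= q * (1 - p) by rewrite mulr_ge0//; lra.
  have pq2 : 0 < (p - q) ^+ 2.
    rewrite exprn_even_gt0//= subr_eq0.
    by apply: contraNneq qxy => <-; rewrite xp.
  have pq1 : 0 < p + q * (1 - p) by lra.
  by rewrite mulr_gt0// mulr_gt0.
Qed.

Let Eq : E q = 0. Proof. by rewrite /E bernoulli_kl_diag; ring. Qed.
Let Aq : A q = 0. Proof. by rewrite /A bernoulli_kl_diag; ring. Qed.

Let E_gt0 p : 0 < p -> p < q -> 0 < E p.
Proof. by move=> p0 pq; rewrite -Eq decrE// ltxx andbF. Qed.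

Let A_gt0 p : 0 < p -> p < q -> 0 < A p.
Proof. by move=> p0 pq; rewrite -Aq decrA// ltxx andbF. Qed.

Let E_lt0 p : q < p -> p < 1 -> E p < 0.
Proof.
(* For [q = 0] the comparison point [q] leaves the domain of [decrE], but [E] is then explicit. *)
move=> qp p1; have [q_eq0|qn0] := eqVneq q 0; last first.
  by rewrite -Eq decrE// ?ltxx// lt0r qn0.
rewrite /E q_eq0 mulr0 mul0r !sub0r sqrrN oppr_lt0 divr_gt0 ?exprn_gt0//; lra.
Qed.

Let A_lt0 p : q < p -> p < 1 -> A p < 0.
Proof.
move=> qp p1; have [q_eq0|qn0] := eqVneq q 0; last first.
  by rewrite -Aq decrA// ?ltxx// lt0r qn0.
rewrite /A /bernoulli_kl q_eq0 subr0 ln1.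
have : ln (1 - p) < 0 by rewrite ln_lt0//; lra.
lra.
Qed.

(** Left of [q], [E p > 0] bounds [2 * q * d p] below by a nonnegative term; right of [q], [A p < 0]
    does so for [2 * (1 - q) * d p]. *)
Lemma bernoulli_kl_gt0 p : 0 < p < 1 -> p != q -> 0 < d p.
Proof.
move=> /andP[p0 p1]; rewrite neq_lt => /orP[pq|pq].
  have q_gt0 : 0 < q by lra.
  have := E_gt0 p0 pq; rewrite subr_gt0 => /(le_lt_trans _) H.
  have {}H : 0 < 2 * q * d p.
    by apply: H; rewrite divr_ge0 ?sqr_ge0//; lra.
  by rewrite pmulr_rgt0 in H; lra.
have := A_lt0 pq p1; rewrite subr_lt0 => /(le_lt_trans _) H.
have {}H : 0 < 2 * (1 - q) * d p.
  by apply: H; rewrite divr_ge0 ?sqr_ge0// mulr_ge0 ?sqr_ge0.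
by rewrite pmulr_rgt0 in H; lra.
Qed.

Let rho p := (q - p) ^+ 2 * (p ^+ 2 * d p)^-1.

Let is_derive_rho p : 0 < p < 1 -> p != q ->
  is_derive p 1 rho ((p - q) * E p / (p ^+ 3 * d p ^+ 2)).
Proof.
move=> p01 pq; have d0 := bernoulli_kl_gt0 p01 pq.
have dd := is_derive_bernoulli_kl p01; case/andP: p01 => p0 p1.
have np : p != 0 by rewrite gt_eqF.
have nd : d p != 0 by rewrite gt_eqF.
have np1 : 1 - p != 0 by rewrite gt_eqF ?subr_gt0.
have nv : p ^+ 2 * d p != 0 by rewrite mulf_neq0 ?expf_neq0.
rewrite /rho; derive_pt.
by rewrite /E; field; rewrite np nd np1.
Qed.

Let decr_rho0 x y : 0 < x -> x < y -> y < 1 -> x != q -> y != q ->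
  ~~ (x < q < y) -> rho y < rho x.
Proof.
move=> x0 xy y1 xq yq qxy.
have neq p : x <= p <= y -> p != q.
  move=> /andP[xp py]; apply: contraNneq qxy => pq.
  by rewrite pq in xp py; rewrite !lt_neqAle xp py xq eq_sym yq.
apply: (@is_derive_lt0_lt _ rho (fun p =>
  (p - q) * E p / (p ^+ 3 * d p ^+ 2)) _ _ xy) => p.
- move=> /andP[xp py]; have p01 : 0 < p < 1 by lra.
  have pq : p != q by apply: neq; rewrite xp.
  exact: is_derive_continuous (is_derive_rho p01 pq).
- move=> /andP[xp py].
  by apply: is_derive_rho; [lra|apply: neq; rewrite !ltW].
- move=> /andP[xp py].
  have pq : p != q by apply: neq; rewrite !ltW.
  have p01 : 0 < p < 1 by lra.
  rewrite pmulr_llt0; last first.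
    rewrite invr_gt0 mulr_gt0 ?exprn_gt0 ?bernoulli_kl_gt0//; lra.
  (* On either side of [q], the factors [p - q] and [E p] have opposite signs. *)
  move: pq; rewrite neq_lt => /orP[pq|pq].
    by rewrite nmulr_rlt0 ?subr_lt0// E_gt0//; lra.
  by rewrite pmulr_rlt0 ?subr_gt0// E_lt0//; lra.
Qed.

Let decr_rho x y : 0 < x -> x < y -> y < 1 -> x != q -> y != q -> rho y < rho x.
Proof.
move=> x0 xy y1 xq yq.
have [/andP[xltq qlty]|] := boolP (x < q < y); last exact: decr_rho0.
have q_gt0 : 0 < q by lra.
have dx : 0 < d x by rewrite bernoulli_kl_gt0//; lra.
have dy : 0 < d y by rewrite bernoulli_kl_gt0//; lra.
have y0 : 0 < y by lra.
(* The limit of [rho] at [q] separates the two sides: [A y < 0] puts [rho y] below it, [A x > 0]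
   puts [rho x] above. *)
apply: (@lt_trans _ _ (2 * (1 - q) / q)).
  rewrite /rho ltr_pdivrMr ?mulr_gt0 ?exprn_gt0// mulrAC ltr_pdivlMr//.
  have := A_lt0 qlty y1; rewrite subr_lt0 ltr_pdivrMr ?exprn_gt0//.
  lra.
rewrite /rho ltr_pdivlMr ?mulr_gt0 ?exprn_gt0// mulrAC ltr_pdivrMr//.
have := A_gt0 x0 xltq; rewrite subr_gt0 ltr_pdivlMr ?exprn_gt0//.
lra.
Qed.

(** * The signed root of the divergence and its derivative *)

Section signed_root.
Variable v : R.
Hypothesis v0 : 0 < v.

(** The signed log-likelihood with the frequency [q] fixed and the parameter varying; [v] stands for
    the number of trials. *)
Definition signed_root p :=
  if q < p then - Num.sqrt (2 * (v * d p)) else Num.sqrt (2 * (v * d p)).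
Local Notation g := signed_root.

(** Off [q] this is [(q - p) / (p * g p)]: numerator and root have the same sign. *)
Definition slope p := `|q - p| / (p * Num.sqrt (2 * (v * d p))).

Lemma sqr_signed_root p : 0 < p < 1 -> g p ^+ 2 = 2 * (v * d p).
Proof.
move=> p01; have dp : 0 <= 2 * (v * d p).
  have [->|pq] := eqVneq p q; first by rewrite bernoulli_kl_diag !mulr0.
  by rewrite !mulr_ge0// ltW// bernoulli_kl_gt0.
by rewrite /g; case: ifP => _; rewrite ?sqrrN sqr_sqrtr.
Qed.

Lemma slope_lt x y : 0 < x -> x < y -> y < 1 -> x != q -> y != q ->
  slope y < slope x.
Proof.
move=> x0 xy y1 xq yq.
have dx : 0 < d x by rewrite bernoulli_kl_gt0//; lra.
have dy : 0 < d y by rewrite bernoulli_kl_gt0//; lra.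
have y0 : 0 < y by lra.
have sqr_slope p : 0 < p -> 0 < d p -> slope p ^+ 2 = rho p / (2 * v).
  move=> p0 dp; rewrite /slope exprMn real_normK ?num_real// exprVn exprMn.
  rewrite sqr_sqrtr ?mulr_ge0 ?ltW// /rho.
  by field; rewrite !gt_eqF.
rewrite -ltr_sqr ?nnegrE; last 2 first.
- by rewrite divr_ge0// mulr_ge0 ?sqrtr_ge0// ltW.
- by rewrite divr_ge0// mulr_ge0 ?sqrtr_ge0// ltW.
by rewrite !sqr_slope// ltr_pM2r ?decr_rho// invr_gt0 mulr_gt0.
Qed.

Lemma is_derive_signed_root p : 0 < p < 1 -> p != q ->
  is_derive p 1 g (- (v * slope p / (1 - p))).
Proof.
move=> p01 pq; have dp := bernoulli_kl_gt0 p01 pq.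
have dd := is_derive_bernoulli_kl p01; case/andP: p01 => p0 p1.
have vd : 0 < 2 * (v * d p) by rewrite !mulr_gt0.
have sd : is_derive p 1 (fun x => Num.sqrt (2 * (v * d x)))
   ((2 * Num.sqrt (2 * (v * d p)))^-1 * (2 * (v * ((p - q) / (p * (1 - p)))))).
  notypeclasses refine
    (is_derive_pt_comp (f := fun x => 2 * (v * d x)) _ (is_derive1_sqrt vd)).
  by derive_pt; ring.
have ns : Num.sqrt (2 * (v * d p)) != 0 by rewrite gt_eqF// sqrtr_gt0.
have np : p != 0 by rewrite gt_eqF.
have np1 : 1 - p != 0 by rewrite gt_eqF ?subr_gt0.
(* Off [q], [g] agrees near [p] with a single branch. *)
move: pq; rewrite neq_lt => /orP[pq|pq].
  apply: (@near_eq_is_derive _ _ _ (fun x => Num.sqrt (2 * (v * d x)))).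
    near=> x; rewrite /g ifF//; apply/negbTE; rewrite -leNgt ltW//.
    by near: x; exact: lt_nbhsl.
  apply: (is_derive_pt_eq sd); rewrite /slope gtr0_norm ?subr_gt0//.
  by field; rewrite np np1 ns.
(* The form [0 - _] lets the difference rule of [derive_step] apply. *)
apply: (@near_eq_is_derive _ _ _ (fun x => 0 - Num.sqrt (2 * (v * d x)))).
  near=> x; rewrite /g sub0r ifT//.
  by near: x; exact: lt_nbhsr.
derive_pt.
rewrite /slope ltr0_norm ?subr_lt0//.
by field; rewrite np np1 ns.
Unshelve. all: by end_near. Qed.

Lemma continuous_signed_root p : 0 < p < 1 -> {for p, continuous g}.
Proof.
move=> p01; have [pq|pq] := eqVneq p q; last first.
  exact: is_derive_continuous (is_derive_signed_root p01 pq).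
have gq0 : g q = 0.
  by rewrite /g ltxx bernoulli_kl_diag !mulr0 sqrtr0.
(* The branches meet at 0 at [q], and [g] in absolute value is the unsigned root, which is
   continuous. *)
rewrite pq /prop_for /continuous_at gq0; apply: norm_cvg0.
have -> : (fun x => `|g x|) = (fun x => Num.sqrt (2 * (v * d x))).
  apply/funext => x; rewrite /g.
  by case: ifP => _; rewrite ?normrN ger0_norm ?sqrtr_ge0.
rewrite -pq; have dd := is_derive_bernoulli_kl p01.
have cd : {for p, continuous (fun x => 2 * (v * d x))}.
  by notypeclasses refine (is_derive_continuous _); repeat derive_step.
have : Num.sqrt (2 * (v * d x)) @[x --> p] --> Num.sqrt (2 * (v * d p)).
  exact: (cvg_comp _ _ cd (@sqrt_continuous R _)).
by rewrite [in X in Num.sqrt X]pq bernoulli_kl_diag !mulr0 sqrtr0.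
Qed.

Lemma signed_root_unbounded p M : 0 < p < 1 ->
  exists2 x, p < x < 1 & g x < M.
Proof.
move=> /andP[p0 p1].
pose c := q * ln q + (1 - q) * ln (1 - q).
pose m := Num.max p q.
have m1 : m < 1 by rewrite gt_max p1.
(* The witness is [1 - expR (- t)]. The first term of [t] places it beyond [p] and [q]; the second
   gives [2 * v * d > M ^+ 2] there, since [d] is at least [c + (1 - q) * t]. *)
pose t := `|ln (1 - m)| + `|(M ^+ 2 / (2 * v) - c) / (1 - q)| + 1.
have q1' : 0 < 1 - q by rewrite subr_gt0.
have tm : expR (- t) < 1 - m.
  rewrite -[ltRHS]lnK ?posrE ?subr_gt0// ltr_expR.
  have := ler_norm (- ln (1 - m)); rewrite normrN.
  have := normr_ge0 ((M ^+ 2 / (2 * v) - c) / (1 - q)).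
  by rewrite /t; lra.
have tM : M ^+ 2 < 2 * (v * (c + (1 - q) * t)).
  rewrite mulrA -ltr_pdivrMl ?mulr_gt0// mulrC -ltrBlDl -ltr_pdivrMl//.
  rewrite mulrC; have := ler_norm ((M ^+ 2 / (2 * v) - c) / (1 - q)).
  have := normr_ge0 (ln (1 - m)).
  by rewrite /t; lra.
have t0 := expR_gt0 (- t).
have [pm qm] : p <= m /\ q <= m by rewrite /m !le_max !lexx orbT.
exists (1 - expR (- t)); first by lra.
have Md : M ^+ 2 < 2 * (v * d (1 - expR (- t))).
  apply: (lt_le_trans tM); rewrite !ler_pM2l// /bernoulli_kl subKr expRK -/c.
  have : q * ln (1 - expR (- t)) <= 0.
    by rewrite mulr_ge0_le0// ln_le0//; lra.
  by lra.
rewrite /g ifT; last by lra.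
rewrite ltrNl (le_lt_trans (ler_norm _))// normrN -sqrtr_sqr ltr_sqrt//.
exact: le_lt_trans (sqr_ge0 _) Md.
Qed.

End signed_root.
End bernoulli_kl.

(** * The intersection property *)

Section upper_bound.
Context {R : realType}.
Variables (n l : nat).
Hypothesis ltln : (l < n)%N.
Let q : R := l%:R / n%:R.
Local Notation g := (signed_root q n%:R).
Local Notation W := (fun p : R => binomial_cdf n l p - Phi (g p)).

Let n0 : 0 < n%:R :> R.
Proof. by rewrite ltr0n (leq_ltn_trans _ ltln). Qed.

Let q0 : 0 <= q. Proof. by rewrite divr_ge0. Qed.

Let q1 : q < 1. Proof. by rewrite ltr_pdivrMr// mul1r ltr_nat. Qed.

Let nq : n%:R * q = l%:R. Proof. by rewrite /q mulrC divfK ?gt_eqF. Qed.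

(** The inverse of the maximum of [p ^+ l * (1 - p) ^+ (n - l)], attained at [p = q]. *)
Let c := expR (- (n%:R * (q * ln q + (1 - q) * ln (1 - q)))).

Let expR_signed_root p : 0 < p < 1 ->
  expR (- g p ^+ 2 / 2) = c * (p ^+ l * (1 - p) ^+ (n - l)).
Proof.
move=> p01; rewrite sqr_signed_root//; case/andP: p01 => p0 p1.
rewrite -{1}[p in RHS]lnK ?posrE// -{1}[1 - p in RHS]lnK ?posrE ?subr_gt0//.
rewrite -!expRM_natl -!expRD; congr expR.
rewrite natrB; last exact: ltnW.
by rewrite -nq /bernoulli_kl; field.
Qed.

Let is_derive_gap p : 0 < p < 1 -> p != q ->
  is_derive p 1 W (p ^+ l * (1 - p) ^+ (n - l).-1 *
    (normal_peak 1 * c * n%:R * slope q n%:R p - (n - l)%:R * 'C(n, l)%:R)).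
Proof.
move=> p01 pq.
have dg := is_derive_signed_root q0 q1 n0 p01 pq.
have dPg := is_derive_pt_comp dg (is_derive_Phi (g p)).
apply: (is_derive_pt_eq (is_derive_ptB (is_derive_binomial_cdf p ltln) dPg)).
rewrite std_normal_pdfE expR_signed_root//.
(* One factor [1 - p] is split off to cancel the denominator in the derivative of [g]. *)
rewrite -[(n - l)%N in X in c * X]prednK ?subn_gt0//.
rewrite exprS; field.
by rewrite subr_eq0 eq_sym lt_eqF//; case/andP: p01.
Qed.

Lemma Phi_signed_root_lt p : 0 < p < 1 -> Phi (g p) < binomial_cdf n l p.
Proof.
move=> p01; rewrite -subr_gt0.
apply: (@gt0_of_derive_sign _ W (fun p => p ^+ l * (1 - p) ^+ (n - l).-1)
  (fun p => normal_peak 1 * c * n%:R * slope q n%:R p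
            - (n - l)%:R * 'C(n, l)%:R)
  q 0 1 _ _ _ _ _ _ p p01) => {p p01}.
- move=> p p01.
  have cF := is_derive_continuous (is_derive_binomial_cdf p ltln).
  have cg := continuous_signed_root q0 q1 n0 p01.
  have cP := is_derive_continuous (is_derive_Phi (g p)).
  by apply: (cvgB cF); exact: (cvg_comp _ _ cg cP).
- exact: is_derive_gap.
- by move=> p /andP[p0 p1]; rewrite mulr_gt0 ?exprn_gt0 ?subr_gt0.
- move=> x y x0 xy y1 xq yq; rewrite ltrD2r ltr_pM2l ?slope_lt//.
  by rewrite !mulr_gt0 ?expR_gt0 ?normal_peak_gt0.
(* Near 0 the binomial tail tends to 1, while [Phi] stays below 1. *)
- move=> x e /andP[x0 x1] e0.
  have cF := is_derive_continuous (is_derive_binomial_cdf (0 : R) ltln).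
  have /cvgrPdist_lt/(_ e e0) := cF.
  rewrite binomial_cdf_at0 => Fe.
  near (0 : R)^'+ => y; exists y.
    by apply/andP; split => //; near: y; exact: nbhs_right_lt.
  have /(le_lt_trans (ler_norm _)) : `|1 - binomial_cdf n l y| < e.
    near: y; exact: cvg_at_right_filter Fe.
  by have := Phi_lt1 (g y); lra.
(* Near 1, [g] takes arbitrarily negative values, so [Phi (g y)] gets below [e] while the tail is
   nonnegative. *)
- move=> x e x01 e0.
  have /cvgrPdist_lt/(_ e e0)[M [_ PhiM]] := @cvg_PhiNy R.
  have [y xy gM] := signed_root_unbounded q0 q1 n0 M x01.
  exists y => //.
  have := PhiM _ gM; rewrite sub0r normrN => /(le_lt_trans (ler_norm _)).
  have : 0 <= binomial_cdf n l y.
    apply: sumr_ge0 => k _; apply: binomial_pmf_ge0.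
    by case/andP: xy x01 => xy y1 /andP[x0 _]; rewrite !ltW// (lt_trans x0).
  by lra.
Unshelve. all: by end_near. Qed.

End upper_bound.

(** * Symmetry and the binomial law *)

Section signed_loglik.
Context {R : realType}.
Variables (n : nat) (p : R).
Hypotheses (n0 : (0 < n)%N) (p0 : 0 < p) (p1 : p < 1).

Let n0R : 0 < n%:R :> R. Proof. by rewrite ltr0n. Qed.

Lemma binomial_signed_loglikE l : (l < n)%N ->
  binomial_signed_loglik n p l%:R = signed_root (l%:R / n%:R) n%:R p.
Proof.
move=> ltln; rewrite /binomial_signed_loglik /signed_root ltr_pdivrMr//.
rewrite [n%:R * p]mulrC /binomial_divergence bernoulli_klE ?divr_ge0 ?p0//.
by rewrite ltr_pdivrMr// mul1r ltr_nat.
Qed.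

Lemma binomial_signed_loglikC (x : R) :
  binomial_signed_loglik n (1 - p) (n%:R - x) = - binomial_signed_loglik n p x.
Proof.
have nn0 : n%:R != 0 :> R by rewrite gt_eqF.
have DC : binomial_divergence n ((n%:R - x) / n%:R) (1 - p) =
    binomial_divergence n (x / n%:R) p.
  rewrite /binomial_divergence mulrBl divff// !subKr; congr (_ * _).
  by rewrite addrC.
rewrite /binomial_signed_loglik DC mulrBr mulr1 ltrD2l ltrN2.
case: ltgtP => [_|_|xnp]; rewrite ?opprK//.
(* At [x = n * p] both sides use the nonnegative branch, so the sign change requires the divergence
   to vanish. *)
have xp : x / n%:R = p by rewrite -xnp mulrAC divff// mul1r.
rewrite /binomial_divergence xp !divff ?gt_eqF ?subr_gt0// ln1.
by rewrite !mulr0 addr0 !mulr0 sqrtr0 oppr0.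
Qed.

Lemma Phi_signed_loglik_lt l : (l <= n)%N ->
  Phi (binomial_signed_loglik n p l%:R) < binomial_cdf n l p.
Proof.
rewrite leq_eqVlt => /predU1P[->|ltln]; last first.
  by rewrite binomial_signed_loglikE// Phi_signed_root_lt// p0.
by rewrite /binomial_cdf sum_binomial_pmf Phi_lt1.
Qed.

Lemma binomial_prob_lt l :
  binomial_prob n p [set k | (k < l)%N] = (\sum_(k < l) binomial_pmf n p k)%:E.
Proof.
have p01 : 0 <= p <= 1 by rewrite !ltW.
rewrite /binomial_prob p01 esum_fset//; last first.
  by move=> k _; rewrite lee_fin binomial_pmf_ge0.
by rewrite -fsbig_ord sumEFin.
Qed.

End signed_loglik.

Theorem theorem11 (R : realType) (d : measure_display) (T : measurableType d)
    (P : probability T R) (n : nat) (p : R) (S : {RV P >-> nat}) (l : nat)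
    (hn : (1 <= n)%N) (hp0 : 0 < p) (hp1 : p < 1)
    (hS : distribution P S = binomial_prob n p :> (set nat -> \bar R))
    (hl : (l <= n)%N) :
  (P [set w | (S w < l)%N] < std_normal_cdf (binomial_signed_loglik n p l%:R))%E
  /\
  (std_normal_cdf (binomial_signed_loglik n p l%:R) < P [set w | (S w <= l)%N])%E.
Proof.
have PS m : P [set w | (S w < m)%N] = (\sum_(k < m) binomial_pmf n p k)%:E.
  by rewrite -binomial_prob_lt// -hS.
(* On [nat], [S w <= l] is [S w < l.+1] by definition. *)
rewrite (PS l) (PS l.+1) std_normal_cdfE !lte_fin; split; last first.
  exact: Phi_signed_loglik_lt.
have p01 : 0 < 1 - p < 1 by lra.
case/andP: p01 => p'0 p'1.
(* The lower bound is the upper bound for [1 - p] and [n - l], complemented on both sides. *)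
have := Phi_signed_loglik_lt hn p'0 p'1 (leq_subr l n).
by rewrite natrB// binomial_signed_loglikC// PhiN binomial_cdfC//; lra.
Qed.
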